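(* Let $n,k\ge 1$ be integers with $k\mid n$. Among all bipartite graphs $G=(X\cup Y,E)$ with $|X|=|Y|=n$ in which every vertex of $X$ has exactly $k$ neighbors in $Y$, the number of perfect matchings is highest for the graph $H$ that is the disjoint union of $n/k$ complete bipartite graphs $K_{k,k}$. That is, $\mathcal{M}(G)\le \mathcal{M}(H)$ for every such $G$.
   Context: Graphs are simple. A bipartite graph $G=(X\cup Y,E)$ has vertex bipartition $X,Y$ with $|X|=|Y|=n$; $X$ is the set of users and $Y$ the set of behaviors. A perfect matching is a set of $n$ edges such that every vertex is incident to exactly one of them. $\mathcal{M}(G)$ denotes the number of perfect matchings of $G$. $K_{k,k}$ is the complete bipartite graph with $k$ vertices on each side (''complete bipartite component of size $k$''); in a disjoint union, each copy contributes $k$ vertices to $X$ and $k$ vertices to $Y$. *)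

(* Defs.v *)
From mathcomp Require Import all_boot.

Set Implicit Arguments.
Unset Strict Implicit.
Unset Printing Implicit Defensive.

(* A finite bipartite graph with a given bipartition (X, Y) is the relation
   saying which x : X and y : Y are joined.  Simplicity, the disjointness of
   the two sides and the absence of edges inside a side are built in. *)
Record bigraph := Bigraph {
  users : finType;
  behaviors : finType;
  adj : users -> behaviors -> bool
}.

Definition edges (G : bigraph) : {set users G * behaviors G} :=
  [set e | adj e.1 e.2].

Definition neighbors (G : bigraph) (x : users G) : {set behaviors G} :=
  [set y | adj x y].

Definition balanced (n : nat) (G : bigraph) : Prop :=
  #|users G| = n /\ #|behaviors G| = n.

Definition user_regular (k : nat) (G : bigraph) : Prop :=
  forall x : users G, #|neighbors x| = k.

(* Meaningful when both sides have the same number n = #|users G| of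
   vertices. *)
Definition perfect_matching (G : bigraph)
    (M : {set users G * behaviors G}) : bool :=
  [&& M \subset edges G,
      #|M| == #|users G|,
      [forall x : users G, #|[set e in M | e.1 == x]| == 1]
    & [forall y : behaviors G, #|[set e in M | e.2 == y]| == 1]].

Definition num_perfect_matchings (G : bigraph) : nat :=
  #|[set M : {set users G * behaviors G} | perfect_matching M]|.

Definition complete_bigraph (k : nat) : bigraph :=
  @Bigraph 'I_k 'I_k (fun _ _ => true).

(* Disjoint union of m copies of G: the first component of a vertex is the
   index of the copy it belongs to. *)
Definition copies (m : nat) (G : bigraph) : bigraph :=
  @Bigraph ('I_m * users G)%type ('I_m * behaviors G)%type
    (fun x y => (x.1 == y.1) && adj x.2 y.2).

(* Main.v *)
(* Schrijver's proof of Bregman's bound  per A <= prod_i (r_i!)^(1/r_i).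
   Let T be the number of perfect matchings and t_e the number of those that
   contain the edge e.  For a user x of degree r, the t_e over the edges e at x
   add up to T, so T^T <= r^T prod_e t_e^(t_e) by AM-GM.  The product of these
   inequalities over all x is a product over the perfect matchings M of the
   numbers prod_x r_x * prod_(e in M) t_e.  By induction t_e is bounded by the
   claim for G minus the two ends of e; for fixed M and x, exactly r_x - 1 of
   the edges of M not at x end in a neighbor of x, so all factors belonging to
   x multiply to (r_x!)^(n/r_x).  Raising everything to the power L = n!, which
   all r_x divide, avoids real roots. *)
Require Import Defs.
From mathcomp Require Import all_boot all_order all_fingroup all_algebra zify.
Import GRing.Theory Num.Theory Order.TTheory.
Set Implicit Arguments.
Unset Strict Implicit.
Unset Printing Implicit Defensive.

(** * AM-GM in integer form *)

Lemma expn_prod (I : Type) (s : seq I) (P : pred I) (F : I -> nat) n :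
  (\prod_(i <- s | P i) F i) ^ n = \prod_(i <- s | P i) F i ^ n.
Proof. by apply: (big_morph (expn^~ n)) => [x y|]; rewrite ?expnMn ?exp1n. Qed.

(** Convexity of t log t with the logarithms removed. The convention 0 ^ 0 = 1 covers the indices
    where [t] vanishes. *)
Lemma leq_expn_sum_prod (I : finType) (D : {set I}) (t : I -> nat) :
  (\sum_(i in D) t i) ^ (\sum_(i in D) t i)
    <= #|D| ^ (\sum_(i in D) t i) * \prod_(i in D) t i ^ t i.
Proof.
set T := \sum_(i in D) t i; have [->|T_gt0] := posnP T.
  by rewrite mul1n prodn_cond_gt0 // => i _; rewrite expn_gt0 orbC; case: (t i).
have t_le i : i \in D -> t i <= T by move=> iD; rewrite /T (bigD1 i) //= leq_addr.
(* Contains [t i] tagged copies of each [i] in [D]; tags in ['I_T] suffice because [t i <= T]. *)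
pose A := [set p : I * 'I_T | (p.1 \in D) && (p.2 < t p.1)].
have bigA (R : Type) (idx : R) (op : Monoid.com_law idx) (F : I -> R) :
    \big[op/idx]_(p in A) F p.1
      = \big[op/idx]_(i in D) iter (t i) (op (F i)) idx.
  under eq_bigl do rewrite inE.
  rewrite -(pair_big_dep (mem D) (fun i (j : 'I_T) => j < t i) (fun i _ => F i)).
  apply: eq_bigr => i iD.
  by rewrite -(big_ord_widen _ (fun _ => F i)) ?t_le // big_const_ord.
have cardA : #|A| = T.
  rewrite -sum1_card (bigA _ _ _ (fun _ => 1)); apply: eq_bigr => i _.
  by rewrite iter_addn_0 mul1n.
Local Open Scope ring_scope.
have tV_ge0 (p : I * 'I_T) : 0 <= (t p.1)%:R^-1 :> rat by rewrite invr_ge0.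
(* AM-GM for the numbers 1/t i, each taken t i times *)
have := (leif_AGM (A := A) (fun p _ => tV_ge0 p)).1.
rewrite cardA => AGM.
(* Each [i] with [t i > 0] contributes exactly 1; the others have no copy in [A], hence only an
   inequality. *)
have sumE : \sum_(p in A) ((t p.1)%:R^-1 : rat) <= #|D|%:R.
  rewrite (bigA _ _ _ (fun i => (t i)%:R^-1)) -sumr_const.
  apply: ler_sum => i _; rewrite iter_addr_0 -[_ *+ _]mulr_natr.
  have [->|ti] := posnP (t i); first by rewrite mulr0.
  by rewrite mulVf // pnatr_eq0 -lt0n.
have prodE : \prod_(p in A) ((t p.1)%:R^-1 : rat)
    = (\prod_(i in D) t i ^ t i)%N%:R^-1.
  rewrite (bigA _ _ _ (fun i => (t i)%:R^-1)) natr_prod -prodfV.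
  by apply: eq_bigr => i _; rewrite iter_mulr_1 exprVn natrX.
have P_gt0 : (0 < \prod_(i in D) t i ^ t i)%N.
  by rewrite prodn_cond_gt0 // => i _; rewrite expn_gt0 orbC; case: (t i).
rewrite -(ler_nat rat) natrM !natrX -ler_pdivrMr ?ltr0n // mulrC.
rewrite -ler_pdivlMr ?exprn_gt0 ?ltr0n // -expr_div_n -prodE.
apply: le_trans AGM _; apply: lerXn2r; rewrite ?nnegrE ?divr_ge0 ?sumr_ge0 //.
by rewrite ler_wpM2r ?invr_ge0.
Qed.
Local Close Scope ring_scope.

(** * Perfect matchings between vertex subsets *)

Section Matchings.
Variables (X Y : finType) (e : X -> Y -> bool).
Implicit Types (A : {set X}) (B : {set Y}) (M : {set X * Y}).

(** Relative to subsets, so that the induction can delete the ends of an edge without changing the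
    vertex types. *)
Definition matchings A B : {set {set X * Y}} :=
  [set M : {set X * Y} | [&&
    M \subset [set p | [&& p.1 \in A, p.2 \in B & e p.1 p.2]],
    [forall x in A, #|[set p in M | p.1 == x]| == 1]
    & [forall y in B, #|[set p in M | p.2 == y]| == 1]]].

Definition joined B x : {set Y} := [set y in B | e x y].

Lemma matchingsP A B M :
  reflect [/\ forall p, p \in M -> [/\ p.1 \in A, p.2 \in B & e p.1 p.2],
              forall x, x \in A -> #|[set p in M | p.1 == x]| = 1
            & forall y, y \in B -> #|[set p in M | p.2 == y]| = 1]
          (M \in matchings A B).
Proof.
rewrite inE; apply: (iffP and3P) => -[sub fstM sndM]; split.
- by move=> p /(subsetP sub); rewrite inE => /and3P.
- by move=> x xA; apply/eqP; move/forall_inP: fstM; apply.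
- by move=> y yB; apply/eqP; move/forall_inP: sndM; apply.
- by apply/subsetP => p /sub ?; rewrite inE; apply/and3P.
- by apply/forall_inP => x /fstM ->.
- by apply/forall_inP => y /sndM ->.
Qed.

Section OneMatching.
Variables (A : {set X}) (B : {set Y}) (M : {set X * Y}).
Hypothesis MAB : M \in matchings A B.

Lemma prod_matching_fst (F : X -> nat) :
  \prod_(p in M) F p.1 = \prod_(x in A) F x.
Proof.
have [sub fstM _] := matchingsP _ _ _ MAB.
rewrite (partition_big (@fst X Y) (mem A)) => [|p /sub[] //] /=.
apply: eq_bigr => x /fstM M1.
rewrite (eq_bigr (fun _ => F x)) => [|p /andP[_ /eqP-> //]].
rewrite prod_nat_const -[RHS]expn1 -M1; congr (_ ^ _).
by apply: eq_card => p; rewrite !inE.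
Qed.

Lemma prod_matching_snd (F : Y -> nat) :
  \prod_(p in M) F p.2 = \prod_(y in B) F y.
Proof.
have [sub _ sndM] := matchingsP _ _ _ MAB.
rewrite (partition_big (@snd X Y) (mem B)) => [|p /sub[] //] /=.
apply: eq_bigr => y /sndM M1.
rewrite (eq_bigr (fun _ => F y)) => [|p /andP[_ /eqP-> //]].
rewrite prod_nat_const -[RHS]expn1 -M1; congr (_ ^ _).
by apply: eq_card => p; rewrite !inE.
Qed.

Lemma card_matching_sides : #|A| = #|B|.
Proof.
(* Products of the constant 2 turn the two product lemmas into cardinality statements. *)
apply: (@expnI 2) => //.
rewrite -!prod_nat_const -(prod_matching_fst (fun _ => 2)).
by rewrite -(prod_matching_snd (fun _ => 2)).
Qed.

Lemma fst_matching_inj : {in M &, injective fst}.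
Proof.
have [sub fstM _] := matchingsP _ _ _ MAB.
move=> p q pM qM pq; have [pA _ _] := sub p pM.
have /eqP/cards1P[z def_z] := fstM _ pA.
have /set1P-> : p \in [set z] by rewrite -def_z !inE pM eqxx.
by apply/esym/set1P; rewrite -def_z !inE qM pq eqxx.
Qed.

Lemma snd_matching_inj : {in M &, injective snd}.
Proof.
have [sub _ sndM] := matchingsP _ _ _ MAB.
move=> p q pM qM pq; have [_ pB _] := sub p pM.
have /eqP/cards1P[z def_z] := sndM _ pB.
have /set1P-> : p \in [set z] by rewrite -def_z !inE pM eqxx.
by apply/esym/set1P; rewrite -def_z !inE qM pq eqxx.
Qed.

Lemma matching_edge x : x \in A -> exists2 y, (x, y) \in M & y \in joined B x.
Proof.
have [sub fstM _] := matchingsP _ _ _ MAB.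
move=> /fstM/eqP/cards1P[[x' y] Mx].
have: (x', y) \in [set p in M | p.1 == x] by rewrite Mx set11.
rewrite !inE /= => /andP[xyM /eqP x'x]; subst x'.
by exists y; rewrite // inE; have [_ -> ->] := sub _ xyM.
Qed.

Lemma matchingsD1 x y : (x, y) \in M -> M :\ (x, y) \in matchings (A :\ x) (B :\ y).
Proof.
have [sub fstM sndM] := matchingsP _ _ _ MAB.
move=> xyM; apply/matchingsP; split.
- move=> p /setD1P[p_xy pM]; have [pA pB ep] := sub _ pM.
  rewrite !inE pA pB ep !andbT; split=> //; apply: contraNneq p_xy => p_xy.
    by apply/eqP/fst_matching_inj.
  by apply/eqP/snd_matching_inj.
- move=> x' /setD1P[x'x /fstM <-]; apply: eq_card => -[u v]; rewrite !inE xpair_eqE.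
  by have [->|] := eqVneq u x'; rewrite ?andbF // (negPf x'x).
- move=> y' /setD1P[y'y /sndM <-]; apply: eq_card => -[u v]; rewrite !inE xpair_eqE.
  by have [->|] := eqVneq v y'; rewrite ?andbF // (negPf y'y) andbF.
Qed.

End OneMatching.

(** * Counting matchings through a given edge *)

Definition matchings_with A B (p : X * Y) :=
  [set M : {set X * Y} in matchings A B | p \in M].

(** Deleting [(x, y)] is injective on the matchings that contain it. *)
Lemma card_matchings_with A B x y :
  #|matchings_with A B (x, y)| <= #|matchings (A :\ x) (B :\ y)|.
Proof.
rewrite -(card_in_imset (f := fun M => M :\ (x, y))) => [|M N].
  apply/subset_leq_card/subsetP => _ /imsetP[M /setIdP[MAB xyM] ->].
  exact: matchingsD1.
by move=> /setIdP[_ xyM] /setIdP[_ xyN] MN; rewrite -(setD1K xyM) MN setD1K.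
Qed.

Lemma card_matchings_partition A B x : x \in A ->
  #|matchings A B| = \sum_(y in joined B x) #|matchings_with A B (x, y)|.
Proof.
move=> xA; rewrite -sum1_card.
under [RHS]eq_bigr do rewrite -sum1_card.
rewrite [RHS](exchange_big_dep (mem (matchings A B))) /= => [|y M _]; last by case/setIdP.
apply: eq_bigr => M MAB; have [y xyM yB] := matching_edge MAB xA.
rewrite (big_pred1 y) => // z; rewrite [M \in _]inE MAB /=.
apply/andP/eqP => [[_ xzM]|->]; last by [].
by have [] : (x, z) = (x, y) by apply: (fst_matching_inj MAB).
Qed.

(** Double counting: on the right the factor of an edge [p] occurs once for each matching through
    [p]. *)
Lemma prod_matchings_with A B :
  \prod_(x in A) \prod_(y in joined B x)
      #|matchings_with A B (x, y)| ^ #|matchings_with A B (x, y)|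
  = \prod_(M in matchings A B) \prod_(p in M) #|matchings_with A B p|.
Proof.
rewrite (pair_big_dep (mem A) (fun x y => y \in joined B x)
  (fun x y => #|matchings_with A B (x, y)| ^ #|matchings_with A B (x, y)|)) /=.
rewrite [RHS](exchange_big_dep (fun p => (p.1 \in A) && (p.2 \in joined B p.1))) /=.
  apply: eq_bigr => -[x y] _; rewrite prod_nat_const; congr (_ ^ _).
  by apply: eq_card => M; rewrite [in LHS]inE.
by move=> M p /matchingsP[sub _ _] /sub[pA pB ep]; rewrite pA inE pB ep.
Qed.

(** * Bregman's bound *)

Lemma card_joined_setD1 B x y : y \in B ->
  #|joined (B :\ y) x| = #|joined B x| - e x y.
Proof.
move=> yB; rewrite [in RHS](cardsD1 y) !inE yB /= addKn.
by apply: eq_card => z; rewrite !inE andbA.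
Qed.

(* With [L] a common multiple of all row sums, [root_fact L r] is the [L]-th
   power of (r!)^(1/r); it is 1 at [r = 0], where [L %/ 0 = 0]. *)
Definition root_fact L r := r`! ^ (L %/ r).

Lemma root_fact_gt0 L r : 0 < root_fact L r.
Proof. by rewrite expn_gt0 fact_gt0. Qed.

(** The case [r = 0] does arise: it is the degree left to a user whose only neighbor is deleted. *)
Lemma root_factX L r : (0 < r -> r %| L) -> root_fact L r ^ r = r`! ^ L.
Proof.
rewrite /root_fact -expnM; case: r => [|r rL]; first by rewrite !exp1n.
by rewrite divnK ?rL.
Qed.

(** With r the degree of [x] and b = [root_fact L], the product on the left is b(r-1)^(r-1) *
    b(r)^(|B|-r): deleting a neighbor of [x] lowers its degree by one, deleting another vertex keeps
    it. Then r^L * (r-1)!^L = r!^L = b(r)^r. *)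
Lemma prod_root_fact_matching L A B M x :
  (forall r, 0 < r <= #|B| -> r %| L) -> M \in matchings A B -> x \in A ->
  #|joined B x| ^ L *
    \prod_(p in M | p.1 != x) root_fact L #|joined (B :\ p.2) x|
  = root_fact L #|joined B x| ^ #|B|.
Proof.
move=> Ldiv MAB xA; have [y xyM yB] := matching_edge MAB xA.
set r := #|joined B x|; pose b := root_fact L; rewrite -/b.
have r_gt0 : 0 < r by rewrite card_gt0; apply/set0Pn; exists y.
have r_le : r <= #|B| by apply/subset_leq_card/subsetP => z /setIdP[].
(* the extra factor accounts for the edge of M at x *)
apply/eqP; rewrite -(eqn_pmul2l (root_fact_gt0 L r.-1)) -/b; apply/eqP.
have: \prod_(p in M) b #|joined (B :\ p.2) x| = b r.-1 ^ r * b r ^ (#|B| - r).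
  rewrite (prod_matching_snd MAB (fun y => b #|joined (B :\ y) x|)).
  rewrite (bigID (e x)) /=; congr (_ * _).
    rewrite (eq_bigr (fun _ => b r.-1)) => [|z /andP[zB exz]].
      by rewrite prod_nat_const; congr (_ ^ _); apply: eq_card => z; rewrite !inE.
    by rewrite card_joined_setD1 // exz subn1.
  rewrite (eq_bigr (fun _ => b r)) => [|z /andP[zB exz]].
    rewrite prod_nat_const; congr (_ ^ _).
    rewrite /r; have <- : B :&: joined B x = joined B x.
      by apply/setP => z; rewrite !inE andbA andbb.
    rewrite -[in RHS](cardsID (joined B x) B) addKn.
    apply: eq_card => z; rewrite !inE unfold_in.
    by case: (z \in B); rewrite ?andbT ?andbF.
  by rewrite card_joined_setD1 // (negPf exz) subn0.
rewrite (bigD1 (x, y)) //= card_joined_setD1; last by case/setIdP: yB.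
have -> : e x y by case/setIdP: yB.
rewrite subn1 -/r => prodE.
have same : \prod_(p in M | p.1 != x) b #|joined (B :\ p.2) x|
    = \prod_(p in M | p != (x, y)) b #|joined (B :\ p.2) x|.
  apply: eq_bigl => p; case pM: (p \in M) => //=; congr (~~ _).
  apply/eqP/eqP => [px|-> //]; exact: (fst_matching_inj MAB).
rewrite same mulnCA prodE -/r.
have r'r : b r.-1 ^ r * r ^ L = b r.-1 * b r ^ r.
  rewrite -[in b r.-1 ^ r](prednK r_gt0) expnS -mulnA; congr (_ * _).
  have -> : b r ^ r = r`! ^ L by apply: root_factX => _; apply: Ldiv; lia.
  have -> : b r.-1 ^ r.-1 = r.-1`! ^ L by apply: root_factX => ?; apply: Ldiv; lia.
  by rewrite -expnMn mulnC -[in RHS](prednK r_gt0) factS prednK.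
by rewrite mulnA [r ^ L * _]mulnC r'r -mulnA -expnD subnKC.
Qed.

(** [L] stays fixed while [B] shrinks in the induction, hence a common multiple rather than the
    factorial of [#|B|]. *)
Theorem bregman L A B : 0 < L -> (forall r, 0 < r <= #|B| -> r %| L) ->
  #|matchings A B| ^ L <= \prod_(x in A) root_fact L #|joined B x|.
Proof.
move=> L_gt0; elim: {A}_.+1 {-2}A (ltnSn #|A|) B => // N IH A leAN B Ldiv.
have [A0|A_gt0] := posnP #|A|.
  rewrite (_ : A = set0) ?big_set0; last exact/cards0_eq.
  rewrite -(exp1n L) leq_exp2r // -(cards1 (set0 : {set X * Y})).
  apply/subset_leq_card/subsetP => M /matchingsP[sub _ _]; rewrite inE.
  by apply/set0Pn => -[p /sub[]]; rewrite inE.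
set T := #|matchings A B|; have [->|T_gt0] := posnP T; first by rewrite exp0n.
have /set0Pn[M0 M0AB] : matchings A B != set0 by rewrite -card_gt0.
have AB := card_matching_sides M0AB.
have step M : M \in matchings A B ->
    (\prod_(x in A) #|joined B x| * \prod_(p in M) #|matchings_with A B p|) ^ L
    <= (\prod_(x in A) root_fact L #|joined B x|) ^ #|B|.
  move=> MAB; have [sub _ _] := matchingsP _ _ _ MAB.
  pose b (p : X * Y) x := root_fact L #|joined (B :\ p.2) x|.
  have leb p : p \in M ->
      #|matchings_with A B p| ^ L <= \prod_(x in A | p.1 != x) b p x.
    case: p => x y /sub[/= xA yB _].
    apply: (@leq_trans (#|matchings (A :\ x) (B :\ y)| ^ L)).
      by rewrite leq_exp2r ?card_matchings_with.
    have -> : \prod_(z in A | x != z) b (x, y) z = \prod_(z in A :\ x) b (x, y) z.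
      by apply: eq_bigl => z; rewrite !inE andbC eq_sym.
    apply: IH; first by move: leAN; rewrite (cardsD1 x) xA.
    by move=> r ?; apply: Ldiv; rewrite (cardsD1 y B) yB; lia.
  (* Multiply the induction bounds over the edges of [M], then regroup the factors by user. *)
  have leMM : \prod_(p in M) #|matchings_with A B p| ^ L
      <= \prod_(x in A) \prod_(p in M | p.1 != x) b p x.
    apply: leq_trans (leq_prod leb) _.
    rewrite (exchange_big_dep (mem A)) //=; last by move=> p x _ /andP[].
    rewrite eq_leq //; apply: eq_bigr => x xA; apply: eq_bigl => p.
    by rewrite xA.
  rewrite expnMn !expn_prod; apply: leq_trans (leq_mul (leqnn _) leMM) _.
  rewrite -big_split eq_leq //; apply: eq_bigr => x xA.
  exact: (prod_root_fact_matching Ldiv MAB xA).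
(* AM-GM at every user; [#|joined B x| ^ T] is spread as one factor over each of the [T]
   matchings. *)
have T_le : T ^ (#|A| * T)
    <= \prod_(M in matchings A B)
         (\prod_(x in A) #|joined B x| * \prod_(p in M) #|matchings_with A B p|).
  rewrite big_split prod_nat_const -prod_matchings_with expn_prod -big_split.
  rewrite mulnC expnM -prod_nat_const; apply: leq_prod => x xA.
  by rewrite {1 2}/T (card_matchings_partition B xA) leq_expn_sum_prod.
(* The [T] bounds of [step] multiply to exponent [#|B| * T], which equals this one since the sides
   have equal size. *)
rewrite -(@leq_exp2r _ _ (#|A| * T)) ?muln_gt0 ?A_gt0 //.
rewrite -expnM mulnC expnM.
apply: (@leq_trans (\prod_(M in matchings A B)
    (\prod_(x in A) root_fact L #|joined B x|) ^ #|B|)).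
  move: T_le; rewrite -(leq_exp2r _ _ L_gt0) => /leq_trans-> //.
  by rewrite expn_prod; apply: leq_prod.
by rewrite prod_nat_const -expnM AB.
Qed.
End Matchings.

(** * Application to regular bipartite graphs *)

Lemma num_perfect_matchingsE (G : bigraph) :
  num_perfect_matchings G = #|matchings (@adj G) setT setT|.
Proof.
apply: eq_card => M; rewrite [in LHS]inE.
have edgesE : edges G = [set p | [&& p.1 \in setT, p.2 \in setT & @adj G p.1 p.2]].
  by apply/setP => p; rewrite !inE.
apply/idP/idP => [/and4P[sub _ /forallP fstM /forallP sndM] | MM].
  by rewrite inE -edgesE sub /=; apply/andP; split; apply/forall_inP.
(* The edge count required by [perfect_matching] follows from there being one edge per user. *)
have cardM : #|M| = #|users G|.
  apply: (@expnI 2) => //; rewrite -prod_nat_const.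
  by rewrite (prod_matching_fst MM (fun _ => 2)) prod_nat_const cardsT.
move: MM; rewrite inE -edgesE /perfect_matching cardM eqxx /=.
case/and3P=> -> /forall_inP fstM /forall_inP sndM /=.
by apply/andP; split; apply/forallP => z; [apply: fstM|apply: sndM].
Qed.

(** One permutation per copy determines a matching. This lower bound meets the upper bound from
    [bregman]. *)
Lemma num_perfect_matchings_copies m k :
  k`! ^ m <= num_perfect_matchings (copies m (complete_bigraph k)).
Proof.
pose H := copies m (complete_bigraph k).
pose M (f : {ffun 'I_m -> {perm 'I_k}}) : {set users H * behaviors H} :=
  [set p | p.2 == (p.1.1, f p.1.1 p.1.2)].
have M_inj : injective M.
  move=> f g /setP fg; apply/ffunP => i; apply/permP => a.
  by have := fg ((i, a), (i, f i a)); rewrite !inE eqxx /= => /esym/eqP[].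
rewrite -card_Sn -[m in _ ^ m]card_ord -card_ffun -(card_imset _ M_inj).
rewrite num_perfect_matchingsE.
apply/subset_leq_card/subsetP => _ /imsetP[f _ ->]; apply/matchingsP; split.
- by move=> p; rewrite !inE => /eqP->; rewrite /= eqxx.
- move=> [i a] _; rewrite -(cards1 ((i, a), (i, f i a))); apply: eq_card => -[u v].
  by rewrite !inE xpair_eqE andbC; case: eqP => // ->.
(* The partner of a behavior is its preimage under the permutation of its copy. *)
- move=> [i a] _; rewrite -(cards1 ((i, (f i)^-1%g a), (i, a))).
  apply: eq_card => -[[u c] v]; rewrite !inE xpair_eqE andbC /=.
  case: (v =P (i, a)) => [->|_]; rewrite ?andbF // andbT !xpair_eqE [i == u]eq_sym.
  by case: (u =P i) => //= ->; rewrite [a == _]eq_sym (canF_eq (permK _)).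
Qed.

Theorem lemma1 (n k : nat) (n_ge1 : 1 <= n) (k_ge1 : 1 <= k) (k_dvd_n : k %| n) :
  let H := copies (n %/ k) (complete_bigraph k) in
  [/\ balanced n H,
      user_regular k H
    & forall G : bigraph, balanced n G -> user_regular k G ->
        num_perfect_matchings G <= num_perfect_matchings H].
Proof.
move=> H; split.
- by rewrite /balanced /= card_prod !card_ord divnK.
- move=> [i a]; rewrite -[RHS]card_ord -cardsT -[RHS]mul1n -(cards1 i) -cardsX.
  by apply: eq_card => -[j b]; rewrite !inE /= eq_sym.
move=> G [cardX cardY] Greg.
rewrite num_perfect_matchingsE -(@leq_exp2r _ _ n`!) ?fact_gt0 //.
have k_le_n : k <= n by exact: dvdn_leq.
have k_dvd : k %| n`! by rewrite dvdn_fact // k_ge1.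
apply: leq_trans (_ : (k`! ^ (n %/ k)) ^ n`! <= _); last first.
  by rewrite leq_exp2r ?fact_gt0 ?num_perfect_matchings_copies.
apply: leq_trans (@bregman _ _ (@adj G) n`! setT setT (fact_gt0 n) _) _.
  by move=> r; rewrite cardsT cardY => r_le; apply: dvdn_fact.
(* All degrees are [k], so the bound is (k!^(n!/k))^n = (k!^(n/k))^(n!), as [k] divides both [n] and
   n!. *)
rewrite (eq_bigr (fun _ => root_fact n`! k)) => [|x _]; last first.
  rewrite -[in RHS](Greg x); congr (root_fact _ _).
  by apply: eq_card => y; rewrite !inE.
by rewrite prod_nat_const cardsT cardX -!expnM mulnC muln_divCA // mulnC.
Qed.
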